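(* Let $H$ be a real Hilbert space, let $K\subseteq H$ be a closed convex cone and let $x\in H\setminus\{0\}$. Then: (i) $\operatorname{ad}(x,K)=\dfrac{2}{\pi}\arccos\left(\dfrac{\langle x,P_Kx\rangle}{\lVert x\rVert\,\lVert P_Kx\rVert}\right)$ if $x\notin K^\circ$, and $\operatorname{ad}(x,K)=1$ if $x\in K^\circ$; (ii) $\operatorname{ad}(x,K)=\dfrac{2}{\pi}\arccos\left(\dfrac{\lVert P_Kx\rVert}{\lVert x\rVert}\right)=\dfrac{2}{\pi}\arccos\left(\dfrac{d(x,K^\circ)}{\lVert x\rVert}\right)$; (iii) $\operatorname{ad}(x,K)=\dfrac{2}{\pi}\arcsin\left(\dfrac{d(x,K)}{\lVert x\rVert}\right)$; (iv) if $x\notin K^\circ$, then $\operatorname{ad}(x,K)=\dfrac{2}{\pi}\arctan\left(\dfrac{d(x,K)}{\lVert P_Kx\rVert}\right)=\dfrac{2}{\pi}\arctan\left(\dfrac{d(x,K)}{d(x,K^\circ)}\right)$; with the convention $\arctan(+\infty)=\pi/2$ (the quotients being read as $+\infty$ when their denominator is $0$), the same formula also covers $x\in K^\circ$; (v) $\operatorname{ad}(x,K)=0$ if and only if $x\in K$, and $\operatorname{ad}(x,K)=1$ if and only if $x\in K^\circ$; (vi) $\operatorname{ad}(x,K)+\operatorname{ad}(x,K^\circ)=1$.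
   Context: $H$ is a real Hilbert space with inner product $\langle\cdot,\cdot\rangle$ and norm $\lVert x\rVert=\sqrt{\langle x,x\rangle}$. A closed convex cone is a nonempty closed set $K\subseteq H$ such that $\lambda x+\mu y\in K$ for all $x,y\in K$ and all real $\lambda,\mu\ge 0$. The dual cone is $K^*=\{x\in H:\langle x,y\rangle\ge 0\text{ for every }y\in K\}$ and the polar cone is $K^\circ=-K^*$ (again a closed convex cone). $d(x,K)=\min_{y\in K}\lVert x-y\rVert$ is the distance from $x$ to $K$, and $P_Kx$ is the metric projection of $x$ onto $K$, i.e. the unique point of $K$ with $\lVert x-P_Kx\rVert=d(x,K)$. For a closed convex cone $K$ and $x\in H\setminus\{0\}$, the normalized angular distance from $x$ to $K$ is \[ \operatorname{ad}(x,K)=\begin{cases}\displaystyle\frac{2}{\pi}\inf_{y\in K\setminus\{0\}}\arccos\left(\frac{\langle x,y\rangle}{\lVert x\rVert\,\lVert y\rVert}\right), & x\notin K^\circ,\\[2ex] 1, & x\in K^\circ.\end{cases} \] *)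

(* Defs.v *)
From HB Require Import structures.
From mathcomp Require Import all_boot all_order all_algebra.
From mathcomp Require Import all_classical all_reals all_analysis.

Set Implicit Arguments.
Unset Strict Implicit.
Unset Printing Implicit Defensive.

Import Order.TTheory GRing.Theory Num.Theory.
Import numFieldNormedType.Exports.

Local Open Scope classical_set_scope.
Local Open Scope ring_scope.

(* A real Hilbert space is a complete normed module [H] over a [realType]
   together with a positive definite symmetric bilinear form
   [dot : {dot H for idfun}] that induces the norm of [H], i.e.
   [forall x, `|x| = Num.sqrt (dot x x)]. *)

Section Cones.
Context {R : realType} {H : completeNormedModType R}.
Variable dot : {dot H for @idfun R}.
Implicit Types (K : set H) (x y : H).

Definition closed_convex_cone K :=
  [/\ K !=set0, closed K &
      forall x y (l m : R), K x -> K y -> 0 <= l -> 0 <= m ->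
        K (l *: x + m *: y)].

Definition dual_cone K : set H := [set x | forall y, K y -> 0 <= dot x y].

Definition polar_cone K : set H := [set - x | x in dual_cone K].

(* For a closed convex cone in a Hilbert space the infimum is attained. *)
Definition set_dist x K : R := inf [set `|x - y| | y in K].

(* [get] selects a point satisfying the condition; when [K] is a closed
   convex cone in a Hilbert space there is exactly one. *)
Definition metric_proj K x : H := get [set p | K p /\ `|x - p| = set_dist x K].

Definition angdist x K : R :=
  if x \in polar_cone K then 1
  else 2 / pi * inf [set acos (dot x y / (`|x| * `|y|)) | y in K `\ 0].

End Cones.

(* Division returns 0 on a zero denominator, hence this version of a / b,
   to which [atan_ext] applies. *)
Definition quot_ext {R : realType} (a b : R) : \bar R :=
  if b == 0 then +oo%E else (a / b)%:E.

Definition atan_ext {R : realType} (t : \bar R) : R :=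
  match t with
  | r%:E => atan r
  | +oo%E => pi / 2
  | -oo%E => - (pi / 2)
  end.

(* Main.v *)
Require Import Defs.
From HB Require Import structures.
From mathcomp Require Import all_boot all_order all_algebra.
From mathcomp Require Import all_classical all_reals all_analysis.
From mathcomp Require Import ring lra.

Import Order.TTheory GRing.Theory Num.Theory.
Import numFieldNormedType.Exports.

Local Open Scope classical_set_scope.
Local Open Scope ring_scope.

(** Everything is read off the Moreau decomposition: [x = p + (x - p)] with [p]
in [K], [x - p] in the polar cone and [p] orthogonal to [x - p]. Such a [p]
exists ([moreau_exists]): by the parallelogram law, points of [K] that nearly
minimize the distance to [x] are close to one another, so completeness gives a
minimizer, and comparing it with [p + t v] for small [t > 0] yields the sign
and orthogonality conditions. Conversely these conditions force [p] to be the
metric projection of [x] on [K] and [`|x - p|] to be the distance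
([moreau_metric_proj], [moreau_set_dist]). They are moreover symmetric: [x - p]
plays for the polar cone the role of [p] for [K] ([moreau_polar]), so the
distance from [x] to the polar cone is [`|p|].

For [y] in [K] we have [dot x y <= dot p y <= `|p| * `|y|], with equality at [y
= p]; as [acos] is decreasing, if [x] is outside the polar cone, the infimum in
the angular distance is [acos (`|p| / `|x|)] ([angdist_acos]). By Pythagoras,
[`|p|] and [`|x - p|] are the legs of a right triangle with hypotenuse [`|x|].
The formulas with [asin] and [atan] say that an angle of that triangle can be
computed from any two sides, the two cases of equality say when one leg
vanishes, and the sum rule says that the two acute angles, which belong to [K]
and to its polar cone, are complementary. *)

(** * Inner product and norm *)

Section InnerProduct.
Context {R : realType} {H : completeNormedModType R}.
Context {dot : {dot H for @idfun R}}.
Context (dot_norm : forall z : H, `|z| = Num.sqrt (dot z z)).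

Lemma dotC (u v : H) : dot u v = dot v u.
Proof. by rewrite (hermC dot) /= expr0 mul1r. Qed.

Lemma dot_sqr (z : H) : dot z z = `|z| ^+ 2.
Proof.
rewrite dot_norm sqr_sqrtr//; have [->|z0] := eqVneq z 0.
  by rewrite linear0l.
by rewrite ltW// neq0_dnorm_gt0.
Qed.

Lemma sqr_normB (u v : H) :
  `|u - v| ^+ 2 = `|u| ^+ 2 - 2 * dot u v + `|v| ^+ 2.
Proof.
rewrite -!dot_sqr linearBl !linearBr/= (dotC v u); ring.
Qed.

Lemma sqr_normD (u v : H) :
  `|u + v| ^+ 2 = `|u| ^+ 2 + 2 * dot u v + `|v| ^+ 2.
Proof.
rewrite -!dot_sqr linearDl !linearDr/= (dotC v u); ring.
Qed.

Lemma dotZr (a : R) (u v : H) : dot u (a *: v) = a * dot u v.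
Proof. exact: linearZr_LR. Qed.

Lemma dotZl (a : R) (u v : H) : dot (a *: u) v = a * dot u v.
Proof. by rewrite dotC dotZr dotC. Qed.

(** Expand the square of the norm of [`|v| *: u - `|u| *: v]. *)
Lemma cauchy_schwarz (u v : H) : dot u v <= `|u| * `|v|.
Proof.
have [->|u0] := eqVneq u 0; first by rewrite linear0l normr0 mul0r.
have [->|v0] := eqVneq v 0; first by rewrite linear0r normr0 mulr0.
have uv0 : 0 < `|u| * `|v| by rewrite mulr_gt0 ?normr_gt0.
have := sqr_ge0 `|(`|v| *: u) - (`|u| *: v)|.
rewrite sqr_normB dotZl dotZr !normrZ !normr_id.
rewrite (_ : _ + _ = (2 * (`|u| * `|v|)) * (`|u| * `|v| - dot u v)); last by ring.
by rewrite pmulr_rge0 ?subr_ge0// mulr_gt0.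
Qed.

Lemma cosine_bounds (u v : H) : -1 <= dot u v / (`|u| * `|v|) <= 1.
Proof.
have [->|u0] := eqVneq u 0; first by rewrite linear0l mul0r lerN10 ler01.
have [->|v0] := eqVneq v 0; first by rewrite linear0r mul0r lerN10 ler01.
have uv0 : 0 < `|u| * `|v| by rewrite mulr_gt0 ?normr_gt0.
rewrite ler_pdivlMr// ler_pdivrMr// mulN1r mul1r cauchy_schwarz andbT.
by rewrite lerNl -linearNl -(normrN u) cauchy_schwarz.
Qed.

(** * Polar cones *)

Lemma polar_coneP (K : set H) (z : H) :
  polar_cone dot K z <-> forall y, K y -> dot z y <= 0.
Proof.
split=> [[w wK <-] y Ky|zK].
  by rewrite linearNl oppr_le0 wK.
exists (- z); last by rewrite opprK.
by move=> y Ky; rewrite linearNl oppr_ge0 zK.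
Qed.

Lemma polar_cone_closed_convex (K : set H) :
  closed_convex_cone (polar_cone dot K).
Proof.
split.
- by exists 0; apply/polar_coneP => y _; rewrite linear0l.
- move=> z zcl; apply/polar_coneP => y Ky; rewrite leNgt; apply/negP => zy0.
  (* If [dot z y > 0], Cauchy-Schwarz keeps [dot w y > 0] for [w] in a ball
     around [z]; the [+ 1] covers [y = 0]. *)
  have y1 : 0 < `|y| + 1 by rewrite ltr_wpDl.
  have e0 : 0 < dot z y / (`|y| + 1) by rewrite divr_gt0.
  have [w [/polar_coneP/(_ _ Ky) wy]] := zcl _ (nbhsx_ballx z _ e0).
  rewrite -ball_normE/= ltr_pdivlMr// => zw.
  have := cauchy_schwarz (z - w) y; rewrite linearBl.
  by have := normr_ge0 (z - w); nra.
- move=> u v l m /polar_coneP uK /polar_coneP vK l0 m0.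
  apply/polar_coneP => y Ky; rewrite linearDl/= !dotZl.
  by have := uK _ Ky; have := vK _ Ky; nra.
Qed.

(** * Moreau decomposition *)

Lemma set_dist_le {K : set H} (x : H) {y : H} : K y -> set_dist x K <= `|x - y|.
Proof.
by move=> Ky; apply: ge_inf; [exists 0 => _ [z _ <-]|exists y].
Qed.

Lemma set_dist_ge0 {K : set H} (x : H) : K !=set0 -> 0 <= set_dist x K.
Proof.
by move=> [y Ky]; apply: lb_le_inf; [exists `|x - y|, y|move=> _ [z _ <-]].
Qed.

(** Parallelogram law, with the midpoint of [y] and [z] lying in [K] by
    convexity and hence at distance at least [set_dist x K] from [x]. *)
Lemma near_minimizers_close {K : set H} {x y z : H} {d : R} :
  closed_convex_cone K -> K y -> K z -> 0 <= d ->
  `|x - y| < set_dist x K + d -> `|x - z| < set_dist x K + d ->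
  `|y - z| ^+ 2 <= 4 * d * (2 * set_dist x K + d).
Proof.
move=> [K0 _ Kcone] Ky Kz d0 xy xz.
have Km : K (2^-1 *: y + 2^-1 *: z) by apply: Kcone; rewrite ?invr_ge0.
have dm := set_dist_le x Km; have D0 := set_dist_ge0 x K0.
have -> : `|y - z| ^+ 2 = 2 * `|x - y| ^+ 2 + 2 * `|x - z| ^+ 2
    - 4 * `|x - (2^-1 *: y + 2^-1 *: z)| ^+ 2.
  rewrite !sqr_normB sqr_normD !linearDr/= !dotZr dotZl !normrZ.
  by rewrite ger0_norm ?invr_ge0//; field.
have sx : `|x - y| ^+ 2 <= (set_dist x K + d) ^+ 2.
  by rewrite lerXn2r ?nnegrE ?addr_ge0// ltW.
have sz : `|x - z| ^+ 2 <= (set_dist x K + d) ^+ 2.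
  by rewrite lerXn2r ?nnegrE ?addr_ge0// ltW.
have sm : set_dist x K ^+ 2 <= `|x - (2^-1 *: y + 2^-1 *: z)| ^+ 2.
  by rewrite lerXn2r ?nnegrE ?dm.
by move: sx sz sm; nra.
Qed.

(** The sets of [e]-approximate minimizers generate a Cauchy filter; its limit
    is a minimizer. *)
Lemma set_dist_attained {K : set H} (x : H) : closed_convex_cone K ->
  exists2 p, K p & `|x - p| <= set_dist x K.
Proof.
move=> Kc; have [K0 Kcl _] := Kc; have D0 := set_dist_ge0 x K0.
set D := set_dist x K in D0 *.
pose B (e : R) := [set y | K y /\ `|x - y| < D + e].
pose F := filter_from [set e : R | 0 < e] B.
have FF : Filter F.
  apply: filter_from_filter; first by exists 1; rewrite /= ltr01.
  move=> i j /= i0 j0; exists (Num.min i j); first by rewrite /= lt_min i0.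
  move=> y [Ky]; rewrite -ltrBlDl lt_min => /andP[yi yj].
  by split; split=> //; rewrite -ltrBlDl.
have FP : ProperFilter F.
  apply: filter_from_proper => e /= e0.
  have [||_ [y Ky <-] yD] := @inf_lt _ [set `|x - y| | y in K] (D + e).
  - by case: K0 => y Ky; exists `|x - y|, y.
  - by rewrite ltrDl.
  - by exists y.
have /cauchy_cvgP/cvg_ex[p Fp] : cauchy F.
  apply: cauchy_exP => e e0.
  (* With [d <= 1] the bound [4 * d * (2 * D + d)] of
     [near_minimizers_close] is at most [d * (8 * D + 4)], which the second
     argument of the minimum makes smaller than [e ^+ 2]. *)
  pose d := Num.min 1 (e ^+ 2 / (8 * D + 5)).
  have c0 : 0 < 8 * D + 5 by lra.
  have d0 : 0 < d by rewrite lt_min ltr01/= divr_gt0// exprn_gt0.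
  have [y [Ky yd]] := @filter_ex _ _ FP (B d) (ex_intro2 _ _ d d0 (fun _ => id)).
  exists y; exists d => // z [Kz zd].
  rewrite -ball_normE/= -(@ltr_pXn2r _ 2) ?nnegrE ?(ltW e0)//.
  apply: le_lt_trans (near_minimizers_close Kc Ky Kz (ltW d0) yd zd) _.
  have d1 : d <= 1 by rewrite ge_min lexx.
  have : d * (8 * D + 5) <= e ^+ 2.
    by rewrite -ler_pdivlMr// ge_min lexx orbT.
  by rewrite -/D; nra.
have FK : F K by exists 1 => [|y []]; rewrite /= ?ltr01.
exists p; first exact: (@closed_cvg _ _ F _ id K Kcl FK p Fp).
apply/ler_addgt0Pr => e e0.
have Fn : `|x - y| @[y --> F] --> `|x - p|.
  by apply: cvg_norm; apply: cvgB => //; exact: cvg_cst.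
have FD : \near F, `|x - F| <= D + e by exists e => // y [_ /ltW].
exact: (@closed_cvg _ _ F _ _ _ (@closed_le _ (D + e)) FD _ Fn).
Qed.

(** The variational characterization of the projection on a cone, stated
    without any minimization so that it transfers to the polar cone. *)
Definition moreau (K : set H) (x p : H) :=
  [/\ K p, polar_cone dot K (x - p) & dot (x - p) p = 0].

(** First-order condition: divide by [t] and let [t] tend to 0. *)
Lemma first_order_le0 {a b : R} : 0 <= b ->
  (forall t, 0 < t -> t <= 1 -> 2 * t * a <= t ^+ 2 * b) -> a <= 0.
Proof.
move=> b0 ab; rewrite leNgt; apply/negP => a0.
(* [t := a / (a + b)] is admissible and gives [2 * a <= t * b < a]. *)
have ab0 : 0 < a + b by lra.
have t0 : 0 < a / (a + b) by rewrite divr_gt0.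
have t1 : a / (a + b) <= 1 by rewrite ler_pdivrMr// mul1r lerDl.
have := ab _ t0 t1; have : a / (a + b) * (a + b) = a by rewrite divfK ?gt_eqF.
set t := a / (a + b) in t0 t1 *; nra.
Qed.

(** A minimizer [p] of the distance works. The admissible directions at [p]
    are all [v] in [K], which gives polarity, and also [- p], since
    [p - t *: p = (1 - t) *: p] stays in the cone for [t <= 1]; together they
    give orthogonality. *)
Lemma moreau_exists {K : set H} (x : H) : closed_convex_cone K ->
  exists p, moreau K x p.
Proof.
move=> Kc; have [p Kp pD] := set_dist_attained x Kc.
have [_ _ Kcone] := Kc.
have le0 v : (forall t, 0 < t -> t <= 1 -> K (p + t *: v)) -> dot (x - p) v <= 0.
  move=> Kv; apply: (@first_order_le0 _ (`|v| ^+ 2)) => [|t t0 t1].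
    exact: sqr_ge0.
  have : `|x - p| ^+ 2 <= `|(x - p) - t *: v| ^+ 2.
    rewrite lerXn2r ?nnegrE// -addrA -opprD.
    exact: le_trans pD (set_dist_le x (Kv t t0 t1)).
  rewrite (sqr_normB (x - p)).
  by rewrite dotZr normrZ (gtr0_norm t0) exprMn; lra.
have polarp : polar_cone dot K (x - p).
  apply/polar_coneP => y Ky; apply: le0 => t t0 t1.
  by rewrite -[p]scale1r; apply: Kcone => //; rewrite ltW.
exists p; split=> //; apply/eqP; rewrite eq_le.
have -> /= : dot (x - p) p <= 0 by have /polar_coneP := polarp; apply.
rewrite -oppr_le0 -linearNr; apply: le0 => t t0 t1.
rewrite scalerN -scaleNr -{1}[p]scale1r -scalerDl -[_ *: p]addr0 -(scale0r p).
by apply: Kcone => //; rewrite subr_ge0.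
Qed.

Section Decomposition.
Context {K : set H} {x p : H} (xp : moreau K x p).

(** Strong form of minimality: the extra term [`|p - y| ^+ 2] is what makes the
    minimizer unique. *)
Lemma moreau_sqr_dist_le {y : H} : K y ->
  `|x - p| ^+ 2 + `|p - y| ^+ 2 <= `|x - y| ^+ 2.
Proof.
move=> Ky; case: xp => _ /polar_coneP/(_ _ Ky) xpy xpp.
rewrite -[x - y](subrKA p) (sqr_normD (x - p)) linearBr/= xpp; lra.
Qed.

Lemma moreau_set_dist : set_dist x K = `|x - p|.
Proof.
case: (xp) => Kp _ _; apply/eqP; rewrite eq_le set_dist_le//=.
apply: lb_le_inf; first by exists `|x - p|, p.
move=> _ [y Ky <-]; rewrite -(@ler_pXn2r _ 2) ?nnegrE//.
by apply: le_trans (moreau_sqr_dist_le Ky); rewrite lerDl sqr_ge0.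
Qed.

Lemma moreau_metric_proj : metric_proj K x = p.
Proof.
case: (xp) => Kp _ _; rewrite /metric_proj.
have [|Kq xq] := @getPex _ [set q | K q /\ `|x - q| = set_dist x K].
  by exists p; rewrite moreau_set_dist.
set q := get _ in Kq xq *.
have := moreau_sqr_dist_le Kq; rewrite xq moreau_set_dist gerDl => pq.
apply/eqP; rewrite eq_sym -subr_eq0 -normr_le0.
by have := normr_ge0 (p - q); nra.
Qed.

(** The conditions defining a decomposition are symmetric because [K] is
    contained in its bipolar and the two parts are orthogonal. *)
Lemma moreau_polar : moreau (polar_cone dot K) x (x - p).
Proof.
case: xp => Kp xpK xpp; split=> //.
  apply/polar_coneP => z /polar_coneP; rewrite subKr dotC; exact.
by rewrite subKr dotC.
Qed.

Lemma moreau_pythagoras : `|p| ^+ 2 + `|x - p| ^+ 2 = `|x| ^+ 2.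
Proof.
case: xp => _ _ xpp; rewrite -[in RHS](subrK p x) (sqr_normD (x - p)) xpp; ring.
Qed.

Lemma moreau_dot : dot x p = `|p| ^+ 2.
Proof. by case: xp => _ _; rewrite linearBl/= dot_sqr => /subr0_eq. Qed.

Lemma polar_cone_moreau0 : polar_cone dot K x <-> p = 0.
Proof.
split=> [/polar_coneP xK|p0]; last by case: xp => _ + _; rewrite p0 subr0.
case: xp => /xK + _ _; rewrite moreau_dot => p0.
by apply/eqP; rewrite -normr_le0; have := normr_ge0 p; nra.
Qed.

Lemma cone_moreau : K x <-> x = p.
Proof.
split=> [Kx|->]; last by case: xp.
have := moreau_sqr_dist_le Kx; rewrite subrr normr0 expr0n/= => h.
apply/eqP; rewrite -subr_eq0 -normr_le0.
by have := normr_ge0 (x - p); have := sqr_ge0 `|p - x|; nra.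
Qed.

End Decomposition.

End InnerProduct.

(** * Inverse trigonometric functions of a right triangle *)

Lemma le_acos {R : realType} (u v : R) :
  -1 <= u -> u <= v -> v <= 1 -> acos v <= acos u.
Proof.
move=> u1 uv v1.
have ui : -1 <= u <= 1 by rewrite u1 (le_trans uv).
have vi : -1 <= v <= 1 by rewrite (le_trans u1).
rewrite leNgt -ltr_cos ?in_itv/= ?acos_ge0 ?acos_lepi//.
by rewrite !acosK ?in_itv// -leNgt.
Qed.

Lemma mul_2_pi_pihalf {R : realType} : 2 / pi * (pi / 2) = 1 :> R.
Proof. by rewrite mulrA divfK ?divff// gt_eqF ?pi_gt0. Qed.

(** A triangle with legs [a], [b] and hypotenuse [c]; [acos (a / c)] is the
    angle between [a] and [c], and [acos (b / c)] the other acute angle. *)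
Section RightTriangle.
Context {R : realType} {a b c : R}.
Context (a0 : 0 <= a) (b0 : 0 <= b) (c0 : 0 < c).
Context (abc : a ^+ 2 + b ^+ 2 = c ^+ 2).

Let ac01 : 0 <= a / c <= 1.
Proof.
rewrite divr_ge0 ?(ltW c0)//= ler_pdivrMr// mul1r.
by rewrite -(@ler_pXn2r _ 2) ?nnegrE ?(ltW c0)// -abc lerDl sqr_ge0.
Qed.

Let acN1 : -1 <= a / c <= 1.
Proof. by case/andP: ac01 => ? ->; rewrite andbT; lra. Qed.

Lemma cos_acos_triangle : cos (acos (a / c)) = a / c.
Proof. by rewrite acosK ?in_itv. Qed.

Lemma sin_acos_triangle : sin (acos (a / c)) = b / c.
Proof.
rewrite sin_acos// (_ : 1 - _ = (b / c) ^+ 2).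
  by rewrite sqrtr_sqr ger0_norm// divr_ge0// ltW.
by have := gt_eqF c0 => /negbT cn0; rewrite !expr_div_n -[b ^+ 2](addKr (a ^+ 2)) abc; field.
Qed.

Lemma acos_triangle_bounds : 0 <= acos (a / c) <= pi / 2.
Proof.
by rewrite acos_ge0//= -acos0 le_acos//; case/andP: ac01; rewrite // lerN10.
Qed.

Lemma acos_asin_triangle : acos (a / c) = asin (b / c).
Proof.
rewrite -sin_acos_triangle sinK// in_itv/=.
by case/andP: acos_triangle_bounds => t0 ->; rewrite andbT; have := pi_ge0 R; lra.
Qed.

(** [0 < a] excludes the angle [pi / 2], where [tan] is not inverted by
    [atan]. *)
Lemma acos_atan_triangle : 0 < a -> acos (a / c) = atan (b / a).
Proof.
move=> ap.
have -> : b / a = tan (acos (a / c)).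
  rewrite /tan cos_acos_triangle sin_acos_triangle.
  by have := gt_eqF c0; have := gt_eqF ap => /negbT ? /negbT ?; field; apply/andP.
rewrite tanK// in_itv/=; case/andP: acos_triangle_bounds => t0 t1.
apply/andP; split; first by have := pi_gt0 R; lra.
rewrite lt_neqAle t1 andbT.
apply/eqP => tE; have := cos_acos_triangle; rewrite tE cos_pihalf => /esym/eqP.
by rewrite mulf_eq0 invr_eq0 !gt_eqF.
Qed.

Lemma acosD_triangle : acos (a / c) + acos (b / c) = pi / 2.
Proof.
rewrite -sin_acos_triangle -cosBpihalf -cosN opprB cosK; first by ring.
rewrite in_itv/=; case/andP: acos_triangle_bounds => t0 t1.
by have := pi_ge0 R; lra.
Qed.

End RightTriangle.

(** * The angular distance through the Moreau decomposition *)

Section AngularDistance.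
Context {R : realType} {H : completeNormedModType R}.
Context {dot : {dot H for @idfun R}}.
Context (dot_norm : forall z : H, `|z| = Num.sqrt (dot z z)).

(** If [p = 0], then [x] is in the polar cone and both sides are 1. Otherwise
    [dot x y <= dot p y <= `|p| * `|y|] on [K] by polarity of [x - p] and
    Cauchy-Schwarz, and [y = p] attains the bound. *)
Lemma angdist_acos {K : set H} {x p : H} : x <> 0 -> moreau (dot := dot) K x p ->
  angdist dot x K = 2 / pi * acos (`|p| / `|x|).
Proof.
move=> /eqP x0 xp; rewrite /angdist.
have nx : 0 < `|x| by rewrite normr_gt0.
case: ifPn => [/set_mem/(polar_cone_moreau0 dot_norm xp) ->|/negP xK].
  by rewrite normr0 mul0r acos0 mul_2_pi_pihalf.
have p0 : p != 0.
  by apply/eqP => pz; apply: xK; apply/mem_set/(polar_cone_moreau0 dot_norm xp).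
have np : 0 < `|p| by rewrite normr_gt0.
have [Kp /polar_coneP polarp _] := xp.
have Ep : dot x p / (`|x| * `|p|) = `|p| / `|x|.
  by rewrite (moreau_dot dot_norm xp) expr2 invfM mulrACA divff ?gt_eqF// mulr1.
congr (_ * _); apply/eqP; rewrite eq_le; apply/andP; split.
  apply: ge_inf; last by exists p; [split=> //; exact/eqP|rewrite Ep].
  by exists 0 => _ [y _ <-]; rewrite acos_ge0// cosine_bounds.
apply: lb_le_inf; first by exists (acos (dot x p / (`|x| * `|p|))), p => //; split=> //; exact/eqP.
move=> _ [y [Ky /eqP y0] <-].
have ny : 0 < `|y| by rewrite normr_gt0.
have xy0 : 0 < `|x| * `|y| by rewrite mulr_gt0.
apply: le_acos.
- by case/andP: (cosine_bounds dot_norm x y).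
- rewrite ler_pdivrMr// mulrA divfK ?gt_eqF//.
  apply: le_trans (cauchy_schwarz dot_norm p y).
  by have := polarp _ Ky; rewrite linearBl/= subr_le0.
- rewrite ler_pdivrMr// mul1r -(@ler_pXn2r _ 2) ?nnegrE//.
  by rewrite -(moreau_pythagoras dot_norm xp) lerDl sqr_ge0.
Qed.

End AngularDistance.

Theorem proposition5p2 (R : realType) (H : completeNormedModType R)
  (dot : {dot H for @idfun R})
  (dot_norm : forall z : H, `|z| = Num.sqrt (dot z z))
  (K : set H) (hK : closed_convex_cone K) (x : H) (hx : x <> 0) :
  (* (i) *)
  ((~ polar_cone dot K x ->
      angdist dot x K
        = 2 / pi * acos (dot x (metric_proj K x) / (`|x| * `|metric_proj K x|))) /\
   (polar_cone dot K x -> angdist dot x K = 1)) /\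
  (* (ii) *)
  (angdist dot x K = 2 / pi * acos (`|metric_proj K x| / `|x|) /\
   angdist dot x K = 2 / pi * acos (set_dist x (polar_cone dot K) / `|x|)) /\
  (* (iii) *)
  angdist dot x K = 2 / pi * asin (set_dist x K / `|x|) /\
  (* (iv) *)
  ((~ polar_cone dot K x ->
      angdist dot x K = 2 / pi * atan (set_dist x K / `|metric_proj K x|) /\
      angdist dot x K
        = 2 / pi * atan (set_dist x K / set_dist x (polar_cone dot K))) /\
   (angdist dot x K
      = 2 / pi * atan_ext (quot_ext (set_dist x K) `|metric_proj K x|) /\
    angdist dot x K
      = 2 / pi * atan_ext (
          quot_ext (set_dist x K) (set_dist x (polar_cone dot K))))) /\
  (* (v) *)
  ((angdist dot x K = 0 <-> K x) /\
   (angdist dot x K = 1 <-> polar_cone dot K x)) /\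
  (* (vi) *)
  angdist dot x K + angdist dot x (polar_cone dot K) = 1.
Proof.
have [p xp] := moreau_exists dot_norm x hK.
have xq := moreau_polar xp.
have /eqP x0 := hx.
have nx : 0 < `|x| by rewrite normr_gt0.
have c0 : 2 / pi != 0 :> R by rewrite gt_eqF// divr_gt0 ?pi_gt0.
have pyth := moreau_pythagoras dot_norm xp.
have np := normr_ge0 p; have nq := normr_ge0 (x - p).
have Eacos := angdist_acos dot_norm hx xp.
have Easin : angdist dot x K = 2 / pi * asin (`|x - p| / `|x|).
  by rewrite Eacos (acos_asin_triangle np nq nx pyth).
have Eatan : p != 0 -> angdist dot x K = 2 / pi * atan (`|x - p| / `|p|).
  by move=> p0; rewrite Eacos (acos_atan_triangle np nq nx pyth) ?normr_gt0.
have Eatan_ext : angdist dot x K =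
    2 / pi * atan_ext (quot_ext `|x - p| `|p|).
  rewrite /quot_ext; case: ifPn => [|]; rewrite normr_eq0.
    by move=> /eqP p0; rewrite Eacos p0 normr0 mul0r acos0.
  exact: Eatan.
have polar0 := polar_cone_moreau0 dot_norm xp.
rewrite (moreau_metric_proj dot_norm xp) (moreau_set_dist dot_norm xp).
rewrite (moreau_set_dist dot_norm xq) subKr.
have polar1 : polar_cone dot K x -> angdist dot x K = 1.
  by move/polar0 => p0; rewrite Eacos p0 normr0 mul0r acos0 mul_2_pi_pihalf.
have atan_polar : ~ polar_cone dot K x ->
    angdist dot x K = 2 / pi * atan (`|x - p| / `|p|).
  by move=> xK; apply: Eatan; apply/eqP => /polar0.
split; [|split; [|split; [|split; [|split]]]] => //.
- split=> // xK; rewrite (moreau_dot dot_norm xp) expr2 invfM mulrACA divff ?mulr1//.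
  by rewrite normr_eq0; apply/eqP => /polar0.
- by split=> // xK; split; exact: atan_polar.
- split; split.
  + rewrite Eacos => /eqP; rewrite mulf_eq0 (negPf c0)/= => /eqP t0.
    have := sin_acos_triangle np nq nx pyth; rewrite t0 sin0 => /esym/eqP.
    rewrite mulf_eq0 invr_eq0 (gt_eqF nx) orbF normr_eq0 subr_eq0 => /eqP.
    by move/(cone_moreau dot_norm xp).
  + move=> /(cone_moreau dot_norm xp) xE.
    by rewrite Eacos -xE divff ?gt_eqF// acos1 mulr0.
  + rewrite Eacos => ad1.
    have t1 : acos (`|p| / `|x|) = pi / 2.
      by apply: (mulfI c0); rewrite ad1 mul_2_pi_pihalf.
    have := cos_acos_triangle np nx pyth; rewrite t1 cos_pihalf => /esym/eqP.
    rewrite mulf_eq0 invr_eq0 (gt_eqF nx) orbF normr_eq0 => /eqP.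
    by move/polar0.
  + exact: polar1.
- rewrite Eacos (angdist_acos dot_norm hx xq) -mulrDr.
  by rewrite (acosD_triangle np nq nx pyth) mul_2_pi_pihalf.
Qed.
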